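(* Let \[ \Sigma_{\mathbf{n},\boldsymbol{\omega}}=\{([T],[\mathbf{x}_1],\ldots,[\mathbf{x}_k])\in\mathbb{P}(S^{\boldsymbol{\omega}}V)\times\mathbb{P}\mid([\mathbf{x}_1],\ldots,[\mathbf{x}_k])\text{ is a singular vector }k\text{-tuple of }T\} \] be the spectral variety of type $(\mathbf{n},\boldsymbol{\omega})$, where $\mathbb{P}=\prod_{i=1}^k\mathbb{P}(V_i)$. The projection $\beta\colon\Sigma_{\mathbf{n},\boldsymbol{\omega}}\to\mathbb{P}$ is surjective, and every fiber of $\beta$ over a $k$-tuple $([\mathbf{x}_1],\ldots,[\mathbf{x}_k])$ with exactly $r$ isotropic components is (identified with) a projective subspace of $\mathbb{P}(S^{\boldsymbol{\omega}}V)$ of codimension \[ \sum_{i=1}^k(n_i-1)-\max\{0,r-1\}. \]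
   Context: Let $k\ge 1$. For $i\in\{1,\ldots,k\}$, $V_i$ is a complex vector space of dimension $n_i\geq 1$, with $\mathbf{n}=(n_1,\ldots,n_k)$, and $\boldsymbol{\omega}=(\omega_1,\ldots,\omega_k)$ is a vector of positive integers. $S^{\boldsymbol{\omega}}V:=\bigotimes_{i=1}^k S^{\omega_i}V_i$. On each $V_i$ fix a quadratic form $q_i$, the complexification of a positive definite real quadratic form on a real form of $V_i$; write also $q_i(\cdot,\cdot)$ for the associated complex symmetric bilinear form. A component $[\mathbf{x}_i]$ is isotropic if $q_i(\mathbf{x}_i)=0$. The Frobenius inner product $q_F$ on $S^{\boldsymbol{\omega}}V$ is the symmetric bilinear form determined by $q_F(\mathbf{x}_1^{\omega_1}\otimes\cdots\otimes\mathbf{x}_k^{\omega_k},\mathbf{y}_1^{\omega_1}\otimes\cdots\otimes\mathbf{y}_k^{\omega_k})=\prod_i q_i(\mathbf{x}_i,\mathbf{y}_i)^{\omega_i}$. For $T\in S^{\boldsymbol{\omega}}V$ and nonzero $\mathbf{x}_j\in V_j$, the contraction $T(\mathbf{x}_1^{\omega_1}\otimes\cdots\otimes\mathbf{x}_i^{\omega_i-1}\otimes\cdots\otimes\mathbf{x}_k^{\omega_k})\in V_i$ is the vector $\mathbf{v}$ such that $q_i(\mathbf{v},\mathbf{y})=q_F(T,\mathbf{x}_1^{\omega_1}\otimes\cdots\otimes\mathbf{x}_i^{\omega_i-1}\cdot\mathbf{y}\otimes\cdots\otimes\mathbf{x}_k^{\omega_k})$ for all $\mathbf{y}\in V_i$.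 A singular vector $k$-tuple of $T$ is a tuple $([\mathbf{x}_1],\ldots,[\mathbf{x}_k])\in\mathbb{P}$ such that for every $i$ the vectors $T(\mathbf{x}_1^{\omega_1}\otimes\cdots\otimes\mathbf{x}_i^{\omega_i-1}\otimes\cdots\otimes\mathbf{x}_k^{\omega_k})$ and $\mathbf{x}_i$ are linearly dependent. *)

(* Defs.v *)
From HB Require Import structures.
From mathcomp Require Import all_boot all_order all_fingroup all_algebra.
From mathcomp Require Import boolp classical_sets functions reals.
From mathcomp Require Import complex.
Set Implicit Arguments.
Unset Strict Implicit.
Unset Printing Implicit Defensive.
Import Order.TTheory GRing.Theory Num.Theory.
Local Open Scope classical_set_scope.
Local Open Scope ring_scope.
Local Open Scope complex_scope.

Section Tensor.
Variable K : fieldType.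

Definition multilinear (I : finType) (W : I -> vectType K) (U : lmodType K)
    (f : (forall i, W i) -> U) : Prop :=
  forall (v : forall i, W i) (i : I),
    linear (fun y : W i => f (dfwith v y)).

(* Tensor products and symmetric powers are given by their universal
   properties, so that statements about them hold in every model; existence is
   proved below (tensor_product_exists, sym_power_exists). *)
Definition is_tensor_product (I : finType) (W : I -> vectType K)
    (S : vectType K) (tau : (forall i, W i) -> S) : Prop :=
  multilinear tau /\
  forall (U : lmodType K) (f : (forall i, W i) -> U), multilinear f ->
    exists2 g : {linear S -> U}, (forall v, g (tau v) = f v) &
      forall h : {linear S -> U}, (forall v, h (tau v) = f v) -> h =1 g.

Definition sym_multilinear (d : nat) (V : vectType K) (U : lmodType K)
    (f : ('I_d -> V) -> U) : Prop :=
  multilinear (W := fun=> V) f /\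
  forall (v : 'I_d -> V) (s : {perm 'I_d}), f (v \o s) = f v.

(* mu v is the product v_0 ... v_(d-1) in S = S^d V. *)
Definition is_sym_power (d : nat) (V : vectType K)
    (S : vectType K) (mu : ('I_d -> V) -> S) : Prop :=
  sym_multilinear mu /\
  forall (U : lmodType K) (f : ('I_d -> V) -> U), sym_multilinear f ->
    exists2 g : {linear S -> U}, (forall v, g (mu v) = f v) &
      forall h : {linear S -> U}, (forall v, h (mu v) = f v) -> h =1 g.

Definition projective (V : vectType K) : Type :=
  {L : {vspace V} | \dim L == 1%N}.

(* p = [x]; in particular x is nonzero. *)
Definition proj_class (V : vectType K) (x : V) (p : projective V) : Prop :=
  val p = <[x]>%VS.

Definition proj_subspace (V : vectType K) (F : {vspace V}) :
    set (projective V) :=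
  [set p | (val p <= F)%VS].

Definition proj_dim (V : vectType K) (F : {vspace V}) : int :=
  (\dim F)%:Z - 1.

Definition proj_codim (V : vectType K) (F : {vspace V}) : int :=
  proj_dim (fullv : {vspace V}) - proj_dim F.

End Tensor.

Section RealForm.
Variables (R : realType) (V : vectType R[i]).

Definition real_form (W : set V) : Prop :=
  [/\ W 0,
      forall (a : R) (u v : V), W u -> W v -> W (a%:C *: u + v) &
      forall v : V, exists! p : V * V,
        [/\ W p.1, W p.2 & v = p.1 + 'i *: p.2]].

(* q is real on W by polarization, so it is the complex bilinear extension of
   its restriction to W. *)
Definition complexified_posdef (q : {symmetric V}) : Prop :=
  exists2 W : set V, real_form W &
    forall u : V, W u -> u != 0 -> exists2 a : R, 0 < a & q u u = a%:C.

End RealForm.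

Section Singular.
Variables (R : realType) (k : nat) (w : 'I_k -> nat).
Variables (V : 'I_k -> vectType R[i]) (q : forall i, {symmetric (V i)}).
Variables (Sym : 'I_k -> vectType R[i]).
Variable mu : forall i, ('I_(w i) -> V i) -> Sym i.
Variables (S : vectType R[i]) (tau : (forall i, Sym i) -> S).

(* x_1^w_1 (x) ... (x) x_k^w_k *)
Definition pow_tensor (x : forall i, V i) : S :=
  tau (fun i => mu (fun _ : 'I_(w i) => x i)).

(* x_1^w_1 (x) ... (x) x_i^(w_i - 1) y (x) ... (x) x_k^w_k, for w_i >= 1: y
   takes the first of the w_i arguments of the symmetric product mu i. *)
Definition pow_tensor_with (x : forall i, V i) (i : 'I_k) (y : V i) : S :=
  tau (dfwith (fun j => mu (fun _ : 'I_(w j) => x j))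
              (mu (fun a : 'I_(w i) => if a == 0%N :> nat then y else x i))).

Definition isotropic (i : 'I_k) (x : V i) : bool := q i x x == 0.

(* Determines qF, since S is spanned by the tensors pow_tensor x; existence is
   frobenius_exists below. *)
Definition is_frobenius (qF : {symmetric S}) : Prop :=
  forall x y : forall i, V i,
    qF (pow_tensor x) (pow_tensor y) = \prod_i q i (x i) (y i) ^+ w i.

Variable qF : {symmetric S}.

(* The unique such vector: see contractionP. *)
Definition contraction (T : S) (x : forall i, V i) (i : 'I_k) : V i :=
  xget 0 [set v | forall y : V i, q i v y = qF T (pow_tensor_with x y)].

Definition singular_tuple (T : S) (x : forall i, V i) : Prop :=
  forall i, ~~ free [:: contraction T x i; x i].

Definition spectral_variety :
    set (projective S * (forall i, projective (V i))) :=
  [set t | exists (T : S) (x : forall i, V i),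
     [/\ proj_class T t.1, forall i, proj_class (x i) (t.2 i) &
         singular_tuple T x]].

End Singular.

Section Existence.
Variable K : fieldType.

Definition linear_of (U V : lmodType K) (f : U -> V) (fl : linear f) :
  {linear U -> V} := HB.pack f (GRing.isLinear.Build _ _ _ _ f fl).

Lemma dfwith_dfwith (I : eqType) (T : I -> Type) (v : forall i, T i) i
    (x y : T i) : dfwith (dfwith v x) y = dfwith v y.
Proof.
apply: functional_extensionality_dep => j.
case: (eqVneq i j) => [<-|ij]; first by rewrite !dfwith_in.
by rewrite !dfwith_out.
Qed.

Lemma dfwith_self (I : eqType) (T : I -> Type) (v : forall i, T i) i :
  dfwith v (v i) = v.
Proof.
apply: functional_extensionality_dep => j.
by case: (eqVneq i j) => [<-|ij]; rewrite ?dfwith_in ?dfwith_out.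
Qed.

Lemma linear_fun_sum (U V : lmodType K) (f : U -> V) (J : finType)
    (c : J -> K) (b : J -> U) : linear f ->
  f (\sum_j c j *: b j) = \sum_j c j *: f (b j).
Proof.
move=> lf; have f0 : f 0 = 0.
  by have := lf (-1) 0 0; rewrite scaler0 addr0 scaleN1r addNr.
by elim/big_rec2: _ => // j y x _ <-; rewrite lf.
Qed.

Lemma multilinear_comp (I : finType) (W : I -> vectType K) (U U' : lmodType K)
    (f : (forall i, W i) -> U) (g : {linear U -> U'}) :
  multilinear f -> multilinear (g \o f).
Proof. by move=> fl v i a y z /=; rewrite fl linearP. Qed.

Lemma multilinear_ext (I : finType) (W : I -> vectType K) (U : lmodType K)
    (f f' : (forall i, W i) -> U) : multilinear f -> multilinear f' ->
  (forall v, (forall i, exists a : 'I_(\dim (fullv : {vspace W i})),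
                v i = (vbasis fullv)`_a) -> f v = f' v) ->
  f =1 f'.
Proof.
move=> fl fl' ff' v.
suff: forall (s : seq I) v, (forall i, i \notin s ->
        exists a : 'I_(\dim (fullv : {vspace W i})), v i = (vbasis fullv)`_a) ->
      f v = f' v by move/(_ (enum I)); apply=> i; rewrite mem_enum.
elim=> [|i s IH] {}v vs; first by apply: ff' => i; apply: vs.
rewrite -(dfwith_self v i) (coord_vbasis (memvf (v i))).
rewrite (linear_fun_sum _ _ (fl v i)) (linear_fun_sum _ _ (fl' v i)).
apply: eq_bigr => a _; congr (_ *: _); apply: IH => j js.
case: (eqVneq i j) js => [<- _|ij js]; first by rewrite dfwith_in; exists a.
by rewrite dfwith_out//; apply: vs; rewrite inE negb_or eq_sym ij.
Qed.

Section Model.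
Variables (I : finType) (W : I -> vectType K).
Let J := {dffun forall i, 'I_(\dim (fullv : {vspace W i}))}.
Let S : vectType K := {ffun J -> K^o}.
Let tau (v : forall i, W i) : S :=
  [ffun j : J => \prod_i coord (vbasis fullv) (j i) (v i)].
Let b (j : J) : forall i, W i := fun i => (vbasis fullv)`_(j i).

Let tau_b j j' : tau (b j) j' = (j == j')%:R.
Proof.
rewrite ffunE; case: eqP => [<-|/eqP jj'].
  rewrite big1// => i _.
  by rewrite /b coord_free ?eqxx// (basis_free (vbasisP _)).
have [i ji] : exists i, j i != j' i.
  apply/existsP; apply: contraNT jj'; rewrite negb_exists => /forallP jj.
  by apply/eqP/ffunP => i; apply/eqP; rewrite -[_ == _]negbK.
rewrite (bigD1 i)//= /b coord_free ?(basis_free (vbasisP _))//.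
by rewrite (negPf ji) mul0r.
Qed.

Let S_sum (T : S) : T = \sum_j T j *: tau (b j).
Proof.
apply/ffunP => j; rewrite sum_ffunE (bigD1 j)//= big1 ?addr0.
  by rewrite ffunE tau_b eqxx /GRing.scale/= mulr1.
by move=> i ij; rewrite ffunE tau_b (negPf ij) /GRing.scale/= mulr0.
Qed.

Let tau_multi : multilinear tau.
Proof.
move=> v i a y z; apply/ffunP => j; rewrite !ffunE.
rewrite !(bigD1 (P := predT) i)//= !dfwith_in linearP /=.
rewrite mulrDl /GRing.scale/= -mulrA; congr (_ * (_ * _) + _ * _).
  by apply: eq_bigr => l li; rewrite !dfwith_out// eq_sym.
by apply: eq_bigr => l li; rewrite !dfwith_out// eq_sym.
Qed.

Lemma tensor_product_exists :
  exists (S : vectType K) (tau : (forall i, W i) -> S), is_tensor_product tau.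
Proof.
exists S, tau; split=> // U f fl.
pose g (T : S) : U := \sum_j T j *: f (b j).
have gl : linear g.
  move=> a x y; rewrite /g scaler_sumr -big_split /=; apply: eq_bigr => j _.
  by rewrite !ffunE scalerDl scalerA.
pose gL : {linear S -> U} :=
  HB.pack g (GRing.isLinear.Build _ _ _ _ g gl).
have gb j : g (tau (b j)) = f (b j).
  rewrite /g (bigD1 j)//= tau_b eqxx scale1r big1 ?addr0// => i ij.
  by rewrite tau_b eq_sym (negPf ij) scale0r.
exists gL => [|h hf x].
  apply: (multilinear_ext (f := gL \o tau)) => //.
    exact: multilinear_comp.
  move=> v vb; pose j : J := [ffun i => projT1 (cid (vb i))].
  suff -> : v = b j by apply: gb.
  apply: functional_extensionality_dep => i.
  by rewrite /b ffunE; case: cid.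
rewrite [x in LHS]S_sum linear_sum /= /g; apply: eq_bigr => j _.
by rewrite linearZ /= hf.
Qed.

End Model.

Lemma dfwith_perm (d : nat) (T : Type) (v : 'I_d -> T) (i : 'I_d) (y : T)
    (s : {perm 'I_d}) :
  dfwith v (i := i) y \o s = dfwith (v \o s) (i := (s^-1)%g i) y.
Proof.
apply: functional_extensionality_dep => j /=.
have [<-|ij] := eqVneq ((s^-1)%g i) j; first by rewrite permKV !dfwith_in.
by rewrite !dfwith_out//; apply: contraNN ij => /eqP->; rewrite permK.
Qed.

Lemma sym_power_exists (d : nat) (V : vectType K) :
  exists (S : vectType K) (mu : ('I_d -> V) -> S), is_sym_power mu.
Proof.
have [T [tau [taul tauU]]] := tensor_product_exists (fun _ : 'I_d => V).
have sigma_ex (s : {perm 'I_d}) :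
    {g : {linear T -> T} | forall v, g (tau v) = tau (v \o s)}.
  have sl : multilinear (W := fun=> V) (fun v : 'I_d -> V => tau (v \o s)).
    by move=> v i a y z; rewrite !dfwith_perm taul.
  by apply: cid; have [g gP _] := tauU _ _ sl; exists g.
pose sg s := linfun (projT1 (sigma_ex s)).
have sgE s v : sg s (tau v) = tau (v \o s).
  by rewrite lfunE /=; case: (sigma_ex s).
pose N := (\sum_(s : {perm 'I_d}) limg (sg s - \1%VF))%VS.
have NN : (N^C :&: N = 0)%VS by rewrite capvC capv_compl.
pose pi := daddv_pi N^C N.
have piD x : pi x + daddv_pi N N^C x = x.
  by apply: daddv_pi_add NN _; rewrite addvC addv_complf memvf.
have piN x : x - pi x \in N.
  by rewrite -{1}[x]piD addrAC subrr add0r memv_pi.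
have pi0 x : x \in N -> pi x = 0.
  move=> xN; apply: (addIr x); rewrite add0r -[RHS]piD.
  by rewrite (daddv_pi_id _ xN)// capv_compl.
pose mu (v : 'I_d -> V) := vsproj N^C (pi (tau v)).
have muE v : vsval (mu v) = pi (tau v) by rewrite vsprojK// memv_pi.
exists (subvs_of N^C%VS), mu; split; first split.
- by move=> v i a y z; rewrite /mu taul !linearP.
- move=> v s; apply: val_inj; rewrite /= !muE; apply/eqP.
  rewrite -subr_eq0 -linearB; apply/eqP/pi0.
  rewrite memvE; apply/(subv_trans _ (sumv_sup s isT (subvv _))).
  rewrite -memvE; apply/memv_imgP; exists (tau v) => //; first exact: memvf.
  by rewrite add_lfunE opp_lfunE sgE id_lfunE.
move=> U f [fl fs]; have [g gf gU] := tauU _ _ fl.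
have gN x : x \in N -> g x = 0.
  move=> /memv_sumP[y yP ->]; rewrite linear_sum big1// => s _.
  have /memv_imgP[t _ ->] := yP s isT.
  suff : g \o projT1 (sigma_ex s) =1 g.
    move=> /(_ t)/= E.
    by rewrite add_lfunE opp_lfunE id_lfunE lfunE linearB /= E subrr.
  by apply: gU => v /=; case: (sigma_ex s) => /= h ->; rewrite gf fs.
exists (g \o vsval) => [v /=|h hf x].
  rewrite muE -gf; apply/eqP; rewrite eq_sym -subr_eq0 -linearB; apply/eqP.
  exact: gN.
have := gU (h \o vsproj N^C \o pi) hf (vsval x) => /= <-.
by rewrite /pi daddv_pi_id ?subvsP// vsvalK.
Qed.

Lemma tensor_product_ext (I : finType) (W : I -> vectType K) (S : vectType K)
    (tau : (forall i, W i) -> S) (U : lmodType K) (g h : {linear S -> U}) :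
  is_tensor_product tau -> (forall v, g (tau v) = h (tau v)) -> g =1 h.
Proof.
move=> [taul tauU] gh x.
by have [g' _ gU] := tauU U _ (multilinear_comp h taul); rewrite !gU.
Qed.

Lemma sym_power_ext (d : nat) (V S : vectType K) (mu : ('I_d -> V) -> S)
    (U : lmodType K) (g h : {linear S -> U}) :
  is_sym_power mu -> (forall v, g (mu v) = h (mu v)) -> g =1 h.
Proof.
move=> [[mul mus] muU] gh x.
have hs : sym_multilinear (h \o mu).
  by split=> [|v s /=]; [exact: multilinear_comp|rewrite mus].
by have [g' _ gU] := muU U _ hs; rewrite !gU.
Qed.

(* Applied with P = multilinear and P = sym_multilinear. *)
Lemma sym_form_exists (X : Type) (S : vectType K) (m : X -> S)
    (P : (X -> K^o) -> Prop) (B : X -> X -> K^o) :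
  (forall f, P f -> exists g : {linear S -> K^o}, forall v, g (m v) = f v) ->
  (forall g h : {linear S -> K^o}, (forall v, g (m v) = h (m v)) -> g =1 h) ->
  (forall phi : X -> {linear S -> K^o},
     (forall v', P (fun v => phi v (m v'))) ->
     forall t, P (fun v => phi v t)) ->
  (forall v', P (B ^~ v')) -> (forall v v', B v v' = B v' v) ->
  exists q : {symmetric S}, forall v v', q (m v) (m v') = B v v'.
Proof.
move=> ex ext cl PB Bsym.
have /choice[phi phiP] v :
    exists g : {linear S -> K^o}, forall v', g (m v') = B v v'.
  have [g gP] := ex _ (PB v); exists g => v'; by rewrite gP Bsym.
have /choice[psi psiP] t :
    exists g : {linear S -> K^o}, forall v, g (m v) = phi v t.
  apply: ex; apply: (cl phi) => v'; rewrite (_ : (fun _ => _) = B ^~ v')//.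
  by apply/funext => v; rewrite phiP.
have psil t' : linear (fun t => psi t t' : K^o).
  move=> a x y; pose h s : K^o := a * psi x s + psi y s.
  have hl : linear h.
    move=> c u v; rewrite /h !linearP /GRing.scale/= !mulrDr !mulrA !(mulrC a).
    by rewrite !addrA; congr (_ + _); rewrite addrAC.
  pose hL : {linear S -> K^o} := HB.pack h (GRing.isLinear.Build _ _ _ _ h hl).
  apply: (ext (psi _) hL) => v; rewrite psiP /= /h !psiP linearP //.
have psisym t t' : psi t t' = psi t' t.
  pose hL s : {linear S -> K^o} :=
    HB.pack (fun t => psi t s : K^o) (GRing.isLinear.Build _ _ _ _ _ (psil s)).
  have psim v s : psi (m v) s = phi v s.
    by apply: ext => v'; rewrite psiP !phiP Bsym.
  apply: (ext (psi t) (hL t)) => v /=; by rewrite psiP psim.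
pose q t t' : K := psi t t'.
have qb : bilinear_for *%R (idfun \; *%R) q.
  split=> u a x y; rewrite /q; first exact: psil.
  by rewrite linearP.
have qh x y : q x y = (-1) ^+ false * idfun (q y x) by rewrite mul1r /q psisym.
pose qB := bilinear_isBilinear.Build K S S K *%R (idfun \; *%R) q qb.
pose qH := isHermitianSesquilinear.Build K S false idfun q qh.
exists (HB.pack_for {symmetric S} q qB qH) => v v'.
by rewrite /= /q psiP phiP.
Qed.

Lemma multilinear_apply (I : finType) (W : I -> vectType K) (X : Type)
    (S : vectType K) (m : X -> S) (phi : (forall i, W i) -> {linear S -> K^o}) :
  (forall g h : {linear S -> K^o}, (forall v, g (m v) = h (m v)) -> g =1 h) ->
  (forall x, multilinear (U := K^o) (fun v => phi v (m x))) ->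
  forall t, multilinear (U := K^o) (fun v => phi v t).
Proof.
move=> ext mphi t v i a y z.
pose h s : K^o := a * phi (dfwith v y) s + phi (dfwith v z) s.
have hl : linear h.
  move=> c s u; rewrite /h !linearP /GRing.scale/= !mulrDr !mulrA !(mulrC a).
  by rewrite !addrA; congr (_ + _); rewrite addrAC.
pose hL : {linear S -> K^o} := HB.pack h (GRing.isLinear.Build _ _ _ _ h hl).
by apply: (ext _ hL) => x; rewrite mphi.
Qed.

Lemma multilinear_prod (I : finType) (W : I -> vectType K)
    (g : forall i, W i -> K^o) :
  (forall i, linear (g i)) ->
  multilinear (U := K^o) (fun v => \prod_i g i (v i) : K^o).
Proof.
move=> gl v i a y z; rewrite /GRing.scale/=.
rewrite !(bigD1 (P := predT) i)//= !dfwith_in gl mulrDl /GRing.scale/= -mulrA.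
by congr (_ * (_ * _) + _ * _); apply: eq_bigr => l li;
  rewrite !dfwith_out// eq_sym.
Qed.

End Existence.

Lemma sym_formC (K : fieldType) (V : vectType K) (q : {symmetric V}) x y :
  q x y = q y x.
Proof. by rewrite hermitian_subproof expr0 mul1r. Qed.

Lemma sym_form_linear (K : fieldType) (V : vectType K) (q : {symmetric V}) x :
  linear (fun y => q y x : K^o) * linear (fun y => q x y : K^o).
Proof.
by split=> a y z; [rewrite linearPl|rewrite linearPr].
Qed.

Lemma frobenius_exists (R : realType) (k : nat) (w : 'I_k -> nat)
    (V : 'I_k -> vectType R[i]) (q : forall i, {symmetric (V i)})
    (Sym : 'I_k -> vectType R[i])
    (mu : forall i, ('I_(w i) -> V i) -> Sym i)
    (S : vectType R[i]) (tau : (forall i, Sym i) -> S) :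
  (forall i, is_sym_power (mu i)) -> is_tensor_product tau ->
  exists qF : {symmetric S}, is_frobenius q mu tau qF.
Proof.
move=> hmu htau.
have Qex i : {Q : {symmetric (Sym i)} |
    forall x y, Q (mu i (fun=> x)) (mu i (fun=> y)) = q i x y ^+ w i}.
  apply: cid.
  pose B (v v' : 'I_(w i) -> V i) : R[i]^o :=
    (w i)`!%:R^-1 * \sum_(s : {perm 'I_(w i)}) \prod_a q i (v a) (v' (s a)).
  have BC v v' : B v v' = B v' v.
    rewrite /B; congr (_ * _); rewrite (reindex_inj invg_inj)/=.
    apply: eq_bigr => s _; rewrite (reindex_inj (@perm_inj _ s)).
    by apply: eq_bigr => a _; rewrite permK sym_formC.
  have [Q QB] : exists Q : {symmetric (Sym i)},
      forall v v', Q (mu i v) (mu i v') = B v v'.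
    apply: (sym_form_exists (P := sym_multilinear (U := R[i]^o))) => //.
    - by move=> f /((hmu i).2 _ _)[g gf _]; exists g.
    - by move=> g h; apply: sym_power_ext.
    - move=> phi hphi t; split.
        apply: (multilinear_apply (m := mu i)) => [g h|x].
          exact: sym_power_ext.
        exact: (hphi x).1.
      by move=> v s; apply: (sym_power_ext (hmu i)) => x; apply: (hphi x).2.
    - move=> v'; split; last first.
        move=> v s; rewrite /B; congr (_ * _).
        rewrite (reindex_inj (mulgI s))/=; apply: eq_bigr => s' _.
        rewrite [RHS](reindex_inj (@perm_inj _ s)); apply: eq_bigr => a _.
        by rewrite permM.
      move=> v j a y z; rewrite /B /GRing.scale/= mulrCA -mulrDr; congr (_ * _).
      rewrite mulr_sumr -big_split; apply: eq_bigr => s _.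
      apply: (multilinear_prod (W := fun=> V i)
        (g := fun l x => q i x (v' (s l)))) => l.
      exact: (sym_form_linear _ _).1.
  exists Q => x y; rewrite QB /B /=.
  rewrite (eq_bigr (fun=> q i x y ^+ w i)); last first.
    by move=> s _; rewrite prodr_const card_ord.
  rewrite sumr_const card_Sn -[X in _ * X]mulr_natl mulKf//.
  by rewrite pnatr_eq0 -lt0n fact_gt0.
pose Q i := projT1 (Qex i).
have QE i x y : Q i (mu i (fun=> x)) (mu i (fun=> y)) = q i x y ^+ w i.
  by rewrite /Q; case: (Qex i).
pose B (v v' : forall i, Sym i) : R[i]^o := \prod_i Q i (v i) (v' i).
have [qF qFB] :
    exists qF : {symmetric S}, forall v v', qF (tau v) (tau v') = B v v'.
  apply: (sym_form_exists (P := multilinear (U := R[i]^o))) => //.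
  - by move=> f /(htau.2 _ _)[g gf _]; exists g.
  - by move=> g h; apply: tensor_product_ext.
  - move=> phi hphi t; apply: (multilinear_apply (m := tau)) => // g h.
    exact: tensor_product_ext.
  - move=> v'; apply: (multilinear_prod (g := fun i x => Q i x (v' i))) => i.
    exact: (sym_form_linear _ _).1.
  - by move=> v v'; apply: eq_bigr => i _; rewrite sym_formC.
by exists qF => x y; rewrite qFB; apply: eq_bigr => i _; rewrite QE.
Qed.

Lemma complexified_posdef_nondegenerate (R : realType) (V : vectType R[i])
    (q : {symmetric V}) : complexified_posdef q ->
  forall v, (forall y, q v y = 0) -> v = 0.
Proof.
move=> [W [W0 _ Wex] Wq] v vq.
have [[u1 u2] [[/= W1 W2 vE] _]] := Wex v.
have := vq (u1 - 'i *: u2); rewrite vE.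
rewrite linearDl !linearBr !linearZl_LR/= !linearZr_LR/=.
rewrite (sym_formC q u2 u1).
rewrite mulrA.
have -> : 'i%C * 'i%C = -1 :> R[i] by rewrite -expr2 sqr_i.
rewrite mulN1r opprK => E.
have {E}: q u1 u1 + q u2 u2 = 0 by rewrite -E addrA subrK.
have q0 u : W u -> exists2 a : R, 0 <= a & q u u = a%:C /\ (a = 0 -> u = 0).
  move=> Wu; have [->|u0] := eqVneq u 0.
    by exists 0 => //; split=> //; rewrite linear0l.
  have [a a0 qa] := Wq u Wu u0; exists a; first exact: ltW.
  by split=> // a0'; rewrite a0' ltxx in a0.
have [a a0 [-> a0u]] := q0 _ W1; have [b b0 [-> b0u]] := q0 _ W2.
move=> [/eqP]; rewrite paddr_eq0// => /andP[/eqP/a0u-> /eqP/b0u->] _.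
by rewrite scaler0 addr0.
Qed.

Lemma contractionP (R : realType) (k : nat) (w : 'I_k -> nat)
    (V : 'I_k -> vectType R[i]) (q : forall i, {symmetric (V i)})
    (Sym : 'I_k -> vectType R[i])
    (mu : forall i, ('I_(w i) -> V i) -> Sym i)
    (S : vectType R[i]) (tau : (forall i, Sym i) -> S) (qF : {symmetric S})
    (T : S) (x : forall i, V i) (i : 'I_k) :
  (1 <= w i)%N -> complexified_posdef (q i) ->
  is_sym_power (mu i) -> is_tensor_product tau ->
  forall v : V i, v = contraction q mu tau qF T x i <->
    forall y : V i, q i v y = qF T (pow_tensor_with mu tau x y).
Proof.
move=> wi hq [[mul _] _] [taul _].
have nd := complexified_posdef_nondegenerate hq.
have ql : linear (fun y : V i => qF T (pow_tensor_with mu tau x y) : R[i]^o).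
  move=> a y z; rewrite /pow_tensor_with.
  have E u : (fun c : 'I_(w i) => if c == 0%N :> nat then u else x i) =
      dfwith (fun=> x i) (i := Ordinal wi) u.
    apply: functional_extensionality_dep => c; case: eqP => c0.
      by rewrite (_ : c = Ordinal wi) ?dfwith_in//; apply: val_inj.
    by rewrite dfwith_out//; apply/eqP => /(congr1 val)/esym.
  by rewrite !E mul taul linearPr.
pose l := linfun (linear_of ql).
have lE y : l y = qF T (pow_tensor_with mu tau x y) by rewrite lfunE.
have qLl (v : V i) : linear (fun y => q i v y : R[i]^o).
  exact: (sym_form_linear _ _).2.
pose qL v := linfun (linear_of (qLl v)).
have qLE v y : qL v y = q i v y by rewrite lfunE.
have qLL : linear qL.
  move=> a u v; apply/lfunP => y.
  by rewrite add_lfunE scale_lfunE !qLE linearPl.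
pose Phi := linfun (linear_of qLL).
have PhiE v : Phi v = qL v by rewrite lfunE.
have kPhi : lker Phi == 0%VS.
  apply/lker0P => u v; rewrite !PhiE => uv.
  apply/eqP; rewrite -subr_eq0; apply/eqP/nd => y.
  have := congr1 (fun f : 'Hom(V i, R[i]^o) => f y) uv.
  by rewrite !qLE linearBl => E; apply/eqP; rewrite subr_eq0; apply/eqP.
have [v0 v0P] : exists v, Phi v = l.
  have : (limg Phi == fullv)%VS.
    rewrite eqEdim subvf /= limg_dim_eq ?(eqP kPhi) ?capv0//.
    by rewrite !dimvf {1}/dim /= (_ : dim R[i]^o = 1%N)// muln1.
  by move=> /eqP E; have := memvf l; rewrite -E => /memv_imgP[v _ ->]; exists v.
have v0y y : q i v0 y = qF T (pow_tensor_with mu tau x y).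
  by rewrite -qLE -PhiE v0P lE.
have u1 v : (forall y, q i v y = qF T (pow_tensor_with mu tau x y)) -> v = v0.
  move=> vy; apply/eqP; rewrite -subr_eq0; apply/eqP/nd => y.
  rewrite linearBl; apply/eqP; rewrite subr_eq0; apply/eqP.
  by rewrite [RHS]v0y; apply: vy.
have c0 : contraction q mu tau qF T x i = v0.
  apply: u1 => y.
  have := xgetPex 0 (ex_intro (fun v => [set v : V i | forall y : V i,
    q i v y = qF T (pow_tensor_with mu tau x y)] v) v0 v0y).
  by apply.
by move=> v; rewrite c0; split=> [->|/u1].
Qed.

(* Main.v *)
Require Import Defs.
From HB Require Import structures.
From mathcomp Require Import all_boot all_order all_fingroup all_algebra.
From mathcomp Require Import boolp classical_sets functions reals.
From mathcomp Require Import complex zify.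
Set Implicit Arguments.
Unset Strict Implicit.
Unset Printing Implicit Defensive.
Import Order.TTheory GRing.Theory Num.Theory.
Local Open Scope classical_set_scope.
Local Open Scope ring_scope.
Local Open Scope complex_scope.

(* Write A_i y for x_1^w_1 (x) ... x_i^(w_i - 1) y ... (x) x_k^w_k. The tuple x is
   singular for T iff T is orthogonal to U = sum_i A_i(x_i^perp). If
   q_i(x_i, z_i) = 1 for all i, polarization gives
   qF(A_i y, z_1^w_1 (x) ... (x) z_k^w_k) = q_i(y, z_i), so a relation
   sum_i A_i u_i + c x_1^w_1 (x) ... (x) x_k^w_k = 0 forces every u_i to be a
   multiple of x_i. Hence U is the direct sum of the images of complements of
   x_i^perp :&: <x_i> in x_i^perp and, as soon as some x_i is isotropic, of the
   line of x_1^w_1 (x) ... (x) x_k^w_k, which is common to all the A_i. *)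

(** * Dimensions of orthogonal complements *)

Section SymmetricForm.
Variables (K : fieldType) (V : vectType K) (q : {symmetric V}).

(** Reading [q x] on a basis of [Y] gives a linear map to row vectors, and it is injective on
    [X]. *)
Lemma nondegenerate_pairing_dim (X Y : {vspace V}) :
  (forall x, x \in X -> {in Y, forall y, q x y = 0} -> x = 0) ->
  (\dim X <= \dim Y)%N.
Proof.
move=> nd; pose f (x : V) : 'rV[K]_(\dim Y) := \row_a q x (vbasis Y)`_a.
have fl : linear f.
  by move=> a x y; apply/rowP => j; rewrite !mxE linearPl.
have ker0 : (X :&: lker (linfun (linear_of fl)))%VS = 0%VS.
  apply/eqP; rewrite -subv0; apply/subvP => x.
  rewrite memv_cap memv_ker lfunE /= => /andP[xX /eqP fx].
  rewrite memv0; apply/eqP/(nd _ xX) => y yY.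
  rewrite (coord_vbasis yY) linear_sumr big1// => a _.
  by rewrite linearZr_LR /=; have /rowP/(_ a) := fx; rewrite !mxE => ->; rewrite mulr0.
rewrite -(limg_dim_eq ker0) (leq_trans (dimvS (subvf _)))//.
by rewrite dimvf /dim /= mul1n.
Qed.

Lemma orthov_line_mem (x y : V) : (y \in orthov q <[x]>) = (q x y == 0).
Proof. by rewrite mem_orthov1 sym_formC. Qed.

(** A complement of [orthov q U] pairs with [U] without kernel on either side, so the two dimensions
    agree. The hypothesis concerns vectors of [U] only, which is the form available for [qF] on
    [singular_conditions]. *)
Lemma dim_orthov (U : {vspace V}) :
  (forall u, u \in U -> (forall y, q u y = 0) -> u = 0) ->
  (\dim (orthov q U) + \dim U = \dim (fullv : {vspace V}))%N.
Proof.
move=> nd; pose F := orthov q U.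
suff -> : \dim U = \dim F^C%VS by rewrite dimv_compl subnKC// dimvS ?subvf.
apply/eqP; rewrite eqn_leq; apply/andP; split; apply: nondegenerate_pairing_dim.
  move=> u uU uF; apply: nd => // y.
  have : y \in (F + F^C)%VS by rewrite addv_complf memvf.
  case/memv_addP => a /mem_orthovP aF [b bF ->].
  by rewrite linearDr /= (uF b bF) addr0 sym_formC aF.
move=> y yF yU; apply/eqP; rewrite -memv0 -(capv_compl F) memv_cap yF andbT.
by apply/mem_orthovP => u /yU.
Qed.

End SymmetricForm.

(** * Nondegenerate forms: dual vectors and lines *)

Section Nondegenerate.
Variables (K : fieldType) (V : vectType K) (q : {symmetric V}).
Hypothesis nd : forall v, (forall y, q v y = 0) -> v = 0.

Lemma dual_vector (x : V) : x != 0 -> exists z, q x z = 1.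
Proof.
move=> x0; have [z qz] : exists z, q x z != 0.
  apply: contrapT => H; move/eqP: x0; apply; apply: nd => y.
  by apply: contrapT => /eqP qy; apply: H; exists y.
by exists ((q x z)^-1 *: z); rewrite linearZr_LR /= mulVf.
Qed.

(** A line is its own double orthogonal: if [q x z = 1], projecting onto the orthogonal of [x] along
    [z] shows [v = q v z *: x]. *)
Lemma mem_line_orth (x v : V) : x != 0 ->
  (v \in <[x]>%VS) <-> (forall y, q x y = 0 -> q v y = 0).
Proof.
move=> x0; split=> [/vlineP[a ->] y xy|H].
  by rewrite linearZl_LR /= xy mulr0.
have [z xz] := dual_vector x0; apply/vlineP; exists (q v z).
apply/eqP; rewrite -subr_eq0; apply/eqP/nd => u.
have /H : q x (u - q x u *: z) = 0.
  by rewrite linearBr linearZr_LR /= xz mulr1 subrr.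
rewrite linearBr linearZr_LR /= => /eqP; rewrite subr_eq0 => /eqP vu.
by rewrite linearBl linearZl_LR /= vu mulrC subrr.
Qed.

End Nondegenerate.

(** * Multilinear maps and polarization *)

Lemma multilinear_scale (K : fieldType) (I : finType) (W : I -> vectType K)
    (U : lmodType K) (f : (forall i, W i) -> U) (c : I -> K) (v : forall i, W i) :
  multilinear f -> f (fun i => c i *: v i) = (\prod_i c i) *: f v.
Proof.
move=> fl.
suff H (s : seq I) : uniq s ->
    f (fun i => if i \in s then c i *: v i else v i) = (\prod_(i <- s) c i) *: f v.
  rewrite [in RHS]/index_enum -H; last by rewrite -enumT enum_uniq.
  by congr f; apply: functional_extensionality_dep => i; rewrite mem_index_enum.
elim: s => [_|i s IH /= /andP[iS us]]; first by rewrite big_nil scale1r.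
rewrite big_cons -scalerA -IH//.
pose A j := if j \in s then c j *: v j else v j.
have /= fs : linear_of (fl A i) (c i *: v i) = c i *: linear_of (fl A i) (v i).
  by rewrite linearZ.
have Ai : dfwith A (v i) = A.
  by rewrite -[RHS](dfwith_self A i) /A (negPf iS).
rewrite Ai in fs; rewrite -fs.
congr f; apply: functional_extensionality_dep => j.
have [<-|ij] := eqVneq i j; first by rewrite dfwith_in inE eqxx.
by rewrite dfwith_out// /A inE eq_sym (negPf ij).
Qed.

(** Along the line [x + t y] a multilinear map is a polynomial in [t], whose linear coefficient is
    its derivative at [x] in direction [y]. The list [s] of moving slots is there for the
    induction. *)
Lemma multilinear_expand (K : fieldType) (I : finType) (W : I -> vectType K)
    (f : (forall i, W i) -> K^o) (s : seq I) (x y : forall i, W i) :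
  multilinear f -> uniq s ->
  exists p : {poly K}, [/\
    forall t, p.[t] = f (fun i => if i \in s then x i + t *: y i else x i),
    p`_0 = f x & p`_1 = \sum_(i <- s) f (dfwith x (y i))].
Proof.
move=> fl; elim: s x => [|i s IH] x /=.
  by exists (f x)%:P; rewrite !coefC big_nil; split=> // t; rewrite hornerC.
case/andP=> iS us.
have [p [pt p0 p1]] := IH x us; have [r [rt r0 _]] := IH (dfwith x (y i)) us.
(* Splitting slot [i] by linearity, [p] keeps [x i] there and [r] puts [y i]; only the constant term
   of [r] reaches the linear coefficient. *)
exists (p + 'X * r); split=> [t||]; last 2 first.
- by rewrite coefD coefXM addr0.
- by rewrite coefD coefXM /= p1 r0 big_cons addrC.
rewrite hornerD hornerM hornerX pt rt.
pose A j := if j \in s then x j + t *: y j else x j.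
have := fl A i t (y i) (x i).
have -> : dfwith A (x i) = A by rewrite -[RHS](dfwith_self A i) /A (negPf iS).
have -> : dfwith A (t *: y i + x i) =
    fun j => if j \in i :: s then x j + t *: y j else x j.
  apply: functional_extensionality_dep => j.
  have [<-|ij] := eqVneq i j; first by rewrite dfwith_in inE eqxx addrC.
  by rewrite dfwith_out// /A inE eq_sym (negPf ij).
move->; rewrite addrC; congr (f A + t * f _).
apply: functional_extensionality_dep => j.
have [<-|ij] := eqVneq i j; first by rewrite !dfwith_in (negPf iS).
by rewrite !dfwith_out.
Qed.

Lemma poly_horner_inj (K : numFieldType) (p r : {poly K}) :
  (forall t, p.[t] = r.[t]) -> p = r.
Proof.
move=> pr; apply/eqP; rewrite -subr_eq0; apply/negP => /negP d0.
pose m := size (p - r).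
(* In characteristic 0 the first [m] natural numbers are distinct roots, one more than the degree
   allows. *)
have := @max_poly_roots _ (p - r) [seq (i%:R : K) | i <- iota 0 m] d0.
rewrite size_map size_iota ltnn => H; suff : false by []; apply: H.
  by apply/allP => t _; rewrite rootE hornerD hornerN pr subrr.
rewrite map_inj_uniq ?iota_uniq// => a b /eqP.
by rewrite eqr_nat => /eqP.
Qed.

(** Two polynomials in [t] with the same values have the same linear coefficient. *)
Lemma multilinear_polarization (K : numFieldType) (I : finType)
    (W : I -> vectType K) (f g : (forall i, W i) -> K^o) (x y : forall i, W i) :
  multilinear f -> multilinear g ->
  (forall t : K, f (fun i => x i + t *: y i) = g (fun i => x i + t *: y i)) ->
  \sum_i f (dfwith x (y i)) = \sum_i g (dfwith x (y i)).
Proof.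
move=> fl gl fg.
have us : uniq (index_enum I) by rewrite /index_enum -enumT enum_uniq.
have [p [pt _ <-]] := multilinear_expand x y fl us.
have [r [rt _ <-]] := multilinear_expand x y gl us.
suff -> : p = r by [].
apply: poly_horner_inj => t; rewrite pt rt.
have E : (fun i => if i \in index_enum I then x i + t *: y i else x i) =
         fun i => x i + t *: y i.
  by apply: functional_extensionality_dep => i; rewrite mem_index_enum.
by rewrite E.
Qed.

(** By symmetry the [d] terms of the polarized sum are equal, and [d] is invertible: it is positive
    since ['I_d] contains [i]. *)
Lemma sym_multilinear_polarization (K : numFieldType) (d : nat) (V : vectType K)
    (f g : ('I_d -> V) -> K^o) (x y : V) (i : 'I_d) :
  sym_multilinear f -> sym_multilinear g ->
  (forall v, f (fun=> v) = g (fun=> v)) ->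
  f (dfwith (fun=> x) (i := i) y) = g (dfwith (fun=> x) (i := i) y).
Proof.
move=> [fl fs] [gl gs] fg.
have H (h : ('I_d -> V) -> K^o) :
    (forall (v : 'I_d -> V) (s : {perm 'I_d}), h (v \o s) = h v) ->
    \sum_j h (dfwith (fun=> x) (i := j) y) = h (dfwith (fun=> x) (i := i) y) *+ d.
  move=> hs; rewrite (eq_bigr (fun=> h (dfwith (fun=> x) (i := i) y))).
    by rewrite sumr_const card_ord.
  (* Transposing [i] and [j] carries [y] from slot [j] to slot [i]. *)
  move=> j _; rewrite -(hs _ (tperm i j)) dfwith_perm tpermV.
  by rewrite tpermR.
have := @multilinear_polarization K _ (fun=> V) f g (fun=> x) (fun=> y) fl gl.
rewrite !H// => /(_ (fun t => fg _)) /eqP.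
by rewrite -subr_eq0 -mulrnBl mulrn_eq0 subr_eq0 -[d == 0]negbK -lt0n (leq_ltn_trans _ (ltn_ord i))// => /eqP.
Qed.

(** * Singular tuples as orthogonality conditions on the tensor *)

Section Spectral.
Variables (R : realType) (k : nat) (w : 'I_k -> nat).
Hypothesis hw : forall i, (1 <= w i)%N.
Variables (V : 'I_k -> vectType R[i]) (q : forall i, {symmetric (V i)}).
Hypothesis hq : forall i, complexified_posdef (q i).
Variables (Sym : 'I_k -> vectType R[i]).
Variable mu : forall i, ('I_(w i) -> V i) -> Sym i.
Hypothesis hSym : forall i, is_sym_power (@mu i).
Variables (S : vectType R[i]) (tau : (forall i, Sym i) -> S).
Hypothesis hS : is_tensor_product tau.
Variables (qF : {symmetric S}) (hqF : is_frobenius q mu tau qF).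

Let nd i := complexified_posdef_nondegenerate (hq i).

(** In [dfwith] form, with slot 0 named by means of [hw], multilinearity of [mu] and [tau] applies
    directly. *)
Lemma pow_tensor_withE (x : forall i, V i) i (y : V i) :
  pow_tensor_with mu tau x y =
  tau (dfwith (fun j => mu (fun _ : 'I_(w j) => x j))
         (mu (dfwith (fun=> x i) (i := Ordinal (hw i)) y))).
Proof.
congr (tau (dfwith _ (mu _))); apply: functional_extensionality_dep => c.
case: eqP => c0; last by rewrite dfwith_out//; apply/eqP => /(congr1 val)/esym.
by rewrite (_ : c = Ordinal (hw i)) ?dfwith_in//; apply: val_inj.
Qed.

Lemma pow_tensor_with_linear (x : forall i, V i) i :
  linear (fun y : V i => pow_tensor_with mu tau x y).
Proof.
by move=> a y z; rewrite !pow_tensor_withE (hSym i).1.1 hS.1.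
Qed.

Lemma pow_tensor_with_self (x : forall i, V i) i :
  pow_tensor_with mu tau x (x i) = pow_tensor mu tau x.
Proof. by rewrite pow_tensor_withE !dfwith_self. Qed.

Lemma pow_tensor_with_scale (x : forall i, V i) (c : 'I_k -> R[i]) i :
  exists a, forall y : V i,
    pow_tensor_with mu tau (fun j => c j *: x j) y =
    a *: pow_tensor_with mu tau x y.
Proof.
(* Every slot contributes its factor [c j], except slot 0 of factor [i], which holds [y]. *)
pose b j (u : 'I_(w j)) :=
  if (j == i) && (u == 0%N :> nat) then 1 else c j.
exists (\prod_j \prod_u b j u) => y.
rewrite -(multilinear_scale _ _ hS.1); congr tau.
apply: functional_extensionality_dep => j.
have [<-|ij] := eqVneq i j.
  rewrite !dfwith_in -(multilinear_scale _ _ (hSym i).1.1); congr (mu _).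
  apply: functional_extensionality_dep => u; rewrite /b eqxx /=.
  by case: eqP; rewrite ?scale1r.
rewrite !dfwith_out// -(multilinear_scale _ _ (hSym j).1.1); congr (mu _).
by apply: functional_extensionality_dep => u; rewrite /b eq_sym (negPf ij).
Qed.

(** [hqF] evaluates [qF] on pure powers only. Both sides come from symmetric multilinear functions
    of the [w i] slots of factor [i] that agree on the diagonal, so polarization gives the mixed
    value. *)
Lemma frobenius_pow_tensor_with (x z : forall i, V i) i (y : V i) :
  qF (pow_tensor_with mu tau x y) (pow_tensor mu tau z) =
  (\prod_(j | j != i) q j (x j) (z j) ^+ w j) *
  (q i y (z i) * q i (x i) (z i) ^+ (w i).-1).
Proof.
set C := \prod_(j | _) _; rewrite pow_tensor_withE.
pose m j := mu (fun _ : 'I_(w j) => x j).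
pose f (v : 'I_(w i) -> V i) : R[i]^o :=
  qF (tau (dfwith m (mu v))) (pow_tensor mu tau z).
pose h (v : 'I_(w i) -> V i) : R[i]^o := \prod_a q i (v a) (z i).
pose g v : R[i]^o := C *: h v.
have fs : sym_multilinear f.
  split=> [v b a u u'|v s]; last by rewrite /f (hSym i).1.2.
  by rewrite /f (hSym i).1.1 hS.1 linearPl.
have gs : sym_multilinear g.
  split=> [v b a u u'|v s].
    have /= E := multilinear_prod (W := fun=> V i) (g := fun _ x => q i x (z i))
      (fun=> (sym_form_linear (q i) (z i)).1) v (i := b) a u u'.
    by rewrite /g /h E scalerDr !scalerA mulrC.
  by congr (C *: _); rewrite /h [RHS](reindex_inj (@perm_inj _ s)).
have fg v : f (fun=> v) = g (fun=> v).
  have -> : f (fun=> v) = qF (pow_tensor mu tau (dfwith x v)) (pow_tensor mu tau z).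
    congr (qF (tau _) _); apply: functional_extensionality_dep => j.
    by have [<-|ij] := eqVneq i j; rewrite ?dfwith_in ?dfwith_out.
  rewrite hqF /g /h prodr_const card_ord (bigD1 i)//= dfwith_in mulrC.
  congr (_ * _); apply: eq_bigr => j ji.
  by rewrite dfwith_out 1?eq_sym.
have := sym_multilinear_polarization (x i) y (Ordinal (hw i)) fs gs fg.
rewrite /f /g /h => ->; congr (_ * _).
rewrite (bigD1 (Ordinal (hw i)))//= dfwith_in; congr (_ * _).
rewrite (eq_bigr (fun=> q i (x i) (z i))) ?prodr_const ?cardC1 ?card_ord//.
by move=> a a0; rewrite dfwith_out 1?eq_sym.
Qed.

(** Dependence says that the contraction lies on the line of [x i], that is, is orthogonal to all
    that [x i] is orthogonal to; the contraction's defining property turns this into a condition on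
    [qF T]. *)
Lemma singular_tupleP (x : forall i, V i) T : (forall i, x i != 0) ->
  singular_tuple q mu tau qF T x <->
  forall i (y : V i), q i (x i) y = 0 -> qF T (pow_tensor_with mu tau x y) = 0.
Proof.
move=> x0.
have cP i y := (contractionP qF T x (hw i) (hq i) (hSym i) hS
  (contraction q mu tau qF T x i)).1 erefl y.
have E i : ~~ free [:: contraction q mu tau qF T x i; x i] <->
    forall y, q i (x i) y = 0 -> qF T (pow_tensor_with mu tau x y) = 0.
  rewrite free_cons seq1_free x0 andbT span_seq1 negbK.
  rewrite (mem_line_orth (@nd i) _ (x0 i)).
  by split=> H y /H; rewrite cP.
by split=> [H i|H i]; apply/E; apply: H.
Qed.

(** Being singular depends only on the classes of the [x i]: rescaling preserves their orthogonals
    and multiplies each mixed tensor by a scalar. *)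
Lemma singular_tuple_scale (x : forall i, V i) (c : 'I_k -> R[i]) T :
  (forall i, c i *: x i != 0) ->
  singular_tuple q mu tau qF T x ->
  singular_tuple q mu tau qF T (fun i => c i *: x i).
Proof.
move=> cx0.
have c0 i : c i != 0 by apply: contraNneq (cx0 i) => ->; rewrite scale0r.
have x0 i : x i != 0 by apply: contraNneq (cx0 i) => ->; rewrite scaler0.
move=> /(singular_tupleP _ x0) H; apply/(singular_tupleP _ cx0) => i y.
rewrite linearZl_LR /= => /eqP; rewrite mulf_eq0 (negPf (c0 i)) => /eqP xy.
have [a ->] := pow_tensor_with_scale x c i.
by rewrite linearZr_LR /= H// mulr0.
Qed.

(* Since [qF] is paired here only with the tensors [pow_tensor z] such that
   [q i (x i) (z i) = 1], nondegeneracy of [qF] is never needed. *)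
Lemma pow_tensor_with_relation (x u : forall i, V i) (c : R[i]) :
  (forall i, x i != 0) ->
  (forall s, qF (\sum_i pow_tensor_with mu tau x (u i) +
                 c *: pow_tensor mu tau x) s = 0) ->
  (forall i, u i \in <[x i]>%VS) /\ ((forall i, u i = 0) -> c = 0).
Proof.
move=> x0 H.
have H' z : (forall i, q i (x i) (z i) = 1) -> \sum_i q i (u i) (z i) + c = 0.
  move=> xz; rewrite -[RHS](H (pow_tensor mu tau z)) linearDl linear_sumlz.
  rewrite linearZl_LR /= hqF [\prod_i _]big1 ?mulr1; last first.
    by move=> i _; rewrite xz expr1n.
  congr (_ + _); apply: eq_bigr => i _; rewrite frobenius_pow_tensor_with.
  rewrite xz expr1n mulr1 big1 ?mul1r// => j _; by rewrite xz expr1n.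
pose z i := projT1 (cid (dual_vector (@nd i) (x0 i))).
have xz i : q i (x i) (z i) = 1 by rewrite /z; case: cid.
split=> [i|u0]; last first.
  by have := H' z xz; rewrite big1 ?add0r// => i _; rewrite u0 linear0l.
apply/(mem_line_orth (@nd i) _ (x0 i)) => v xv.
(* Moving [z i] by a vector [v] orthogonal to [x i] keeps the normalization, so subtracting the two
   relations leaves [q i (u i) v = 0]. *)
have xz' j : q j (x j) (dfwith z (z i + v) j) = 1.
  have [<-|ij] := eqVneq i j; last by rewrite dfwith_out.
  by rewrite dfwith_in linearDr /= xz xv addr0.
have /addIr := etrans (H' _ xz') (esym (H' z xz)).
rewrite !(bigD1 (P := predT) i)//= dfwith_in linearDr /=.
rewrite (eq_bigr (fun j => q j (u j) (z j))).
  by move=> /addIr/eqP; rewrite -subr_eq0 addrAC subrr add0r => /eqP.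
by move=> j ji; rewrite dfwith_out// eq_sym.
Qed.

(** * The linear space of tensors for which a fixed tuple is singular *)

Section Fiber.
Variable x : forall i, V i.
Hypothesis x0 : forall i, x i != 0.

Definition pow_tensor_map i : 'Hom(V i, S) :=
  linfun (linear_of (pow_tensor_with_linear x (i := i))).

Definition perp i : {vspace V i} := orthov (q i) <[x i]>.

(** The space [U] of the opening comment. *)
Definition singular_conditions : {vspace S} :=
  (\sum_i pow_tensor_map i @: perp i)%VS.

Definition singular_space : {vspace S} := orthov qF singular_conditions.

Lemma pow_tensor_mapE i y : pow_tensor_map i y = pow_tensor_with mu tau x y.
Proof. by rewrite lfunE. Qed.

Lemma mem_singular_space T :
  T \in singular_space <-> singular_tuple q mu tau qF T x.
Proof.
rewrite (singular_tupleP T x0); split=> [/mem_orthovP H i y xy|H].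
  rewrite -pow_tensor_mapE; apply: H; rewrite memvE (sumv_sup i)// -memvE.
  by apply: memv_img; rewrite orthov_line_mem xy.
apply/mem_orthovP => _ /memv_sumP[v vP ->].
rewrite linear_sumr big1// => i _.
have /memv_imgP[y yP ->] := vP i isT.
by rewrite pow_tensor_mapE; apply: H; apply/eqP; rewrite -orthov_line_mem.
Qed.

Lemma perp_cap_line i :
  (perp i :&: <[x i]> = if isotropic q (x i) then <[x i]> else 0)%VS.
Proof.
have xE a : (a *: x i \in perp i) = (a * q i (x i) (x i) == 0).
  by rewrite orthov_line_mem linearZr_LR.
apply/vspaceP => v; rewrite memv_cap; apply/andP/idP => [[vP]|].
  case/vlineP=> a vE; move: vP; rewrite vE xE mulf_eq0 orbC /isotropic.
  by case: eqP => //= [_ _|_ /eqP->]; rewrite ?scale0r ?mem0v// memvZ ?memv_line.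
rewrite /isotropic; case: eqP => [xx|_].
  by move=> vx; split=> //; case/vlineP: vx => a ->; rewrite xE xx mulr0.
by rewrite memv0 => /eqP->; rewrite !mem0v.
Qed.

(** [perp i] is a hyperplane; removing the line of [x i] costs one more dimension exactly when the
    line lies in it. *)
Lemma dim_perp_diff i :
  (\dim (perp i :\: <[x i]>) + isotropic q (x i) =
   (\dim (fullv : {vspace V i})).-1)%N.
Proof.
have <- : \dim (perp i) = (\dim (fullv : {vspace V i})).-1.
  rewrite -(dim_orthov (q := q i) (U := <[x i]>)) ?dim_vline ?x0 ?addn1//.
  by move=> u _; apply: nd.
rewrite -(dimv_cap_compl (perp i) <[x i]>) addnC perp_cap_line.
by case: isotropic; rewrite ?dimv0 ?dim_vline ?x0.
Qed.

(* Each isotropic [x i] lies in [perp i] and contributes the same line, that of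
   [pow_tensor x]: whence the correction [max 0 (r - 1)]. *)
Lemma singular_conditionsE :
  singular_conditions =
  (\sum_i pow_tensor_map i @: (perp i :\: <[x i]>) +
   if [exists i, isotropic q (x i)] then <[pow_tensor mu tau x]> else 0)%VS.
Proof.
rewrite /singular_conditions.
rewrite (eq_bigr (fun i => pow_tensor_map i @: (perp i :\: <[x i]>) +
    pow_tensor_map i @: (perp i :&: <[x i]>))%VS); last first.
  by move=> i _; rewrite -limgD addv_diff_cap.
rewrite big_split /=; congr (_ + _)%VS.
have E i : (pow_tensor_map i @: (perp i :&: <[x i]>) =
    if isotropic q (x i) then <[pow_tensor mu tau x]> else 0)%VS.
  rewrite perp_cap_line; case: ifP => _; last by rewrite limg0.
  by rewrite limg_line pow_tensor_mapE pow_tensor_with_self.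
rewrite (eq_bigr _ (fun i _ => E i)).
case: existsP => [[i xi]|H]; last first.
  by rewrite big1// => i _; case: ifP => // xi; case: H; exists i.
apply/eqP; rewrite eqEsubv (sumv_sup i) ?xi// andbT.
by apply/subv_sumP => j _; case: ifP; rewrite ?subvv ?sub0v.
Qed.

Lemma perp_diff_line i u : u \in (perp i :\: <[x i]>)%VS -> u \in <[x i]>%VS ->
  u = 0.
Proof.
move=> uC ux; apply/eqP.
by rewrite -memv0 -(capv_diff (perp i) <[x i]>) memv_cap uC.
Qed.

(** The preimages of the [v i] are multiples of [x i] lying in a complement that meets that line in
    0. Assuming orthogonality to all of [S], rather than a vanishing sum, yields both the direct sum
    decomposition and the nondegeneracy used in [dim_singular_space]. *)
Lemma singular_conditions_relation (v : 'I_k -> S) c :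
  (forall i, v i \in (pow_tensor_map i @: (perp i :\: <[x i]>))%VS) ->
  (forall s, qF (\sum_i v i + c *: pow_tensor mu tau x) s = 0) ->
  (forall i, v i = 0) /\ c = 0.
Proof.
move=> vC H.
have uex i : {u : V i |
    u \in (perp i :\: <[x i]>)%VS /\ v i = pow_tensor_with mu tau x u}.
  apply: cid; have /memv_imgP[u uC ->] := vC i.
  by exists u; rewrite pow_tensor_mapE.
pose u i := projT1 (uex i).
have uP i : u i \in _ /\ v i = pow_tensor_with mu tau x (u i) := projT2 (uex i).
have [|ux c0] := pow_tensor_with_relation (u := u) (c := c) x0.
  move=> s; rewrite -[RHS](H s); congr (qF (_ + _) s).
  by apply: eq_bigr => i _; rewrite (uP i).2.
have u0 i : u i = 0 by apply: (perp_diff_line (uP i).1).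
split; last exact: c0.
by move=> i; rewrite (uP i).2 u0 -pow_tensor_mapE linear0.
Qed.

Lemma pow_tensor_neq0 : pow_tensor mu tau x != 0.
Proof.
apply/eqP => e0.
(* If the tensor were 0, the relation with zero summands and coefficient 1 would give [1 = 0]. *)
have [i|s|_ /eqP] := @singular_conditions_relation (fun=> 0) 1.
- exact: mem0v.
- by rewrite big1// e0 scaler0 add0r linear0l.
by rewrite oner_eq0.
Qed.

(** The sum in [singular_conditionsE] is direct and each [pow_tensor_map i] is injective on its
    summand. The isotropic count stands on the left to avoid truncated subtraction; the boolean on
    the right counts the common line. *)
Lemma dim_singular_conditions :
  (\dim singular_conditions + #|[pred i | isotropic q (x i)]| =
   \sum_i (\dim (fullv : {vspace V i})).-1 + [exists i, isotropic q (x i)])%N.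
Proof.
pose A i := (pow_tensor_map i @: (perp i :\: <[x i]>))%VS.
have rel0 (v : 'I_k -> S) c : (forall i, v i \in A i) ->
    \sum_i v i + c *: pow_tensor mu tau x = 0 -> (forall i, v i = 0) /\ c = 0.
  move=> vA v0; apply: singular_conditions_relation => // s.
  by rewrite v0 linear0l.
have dA i : \dim (A i) = \dim (perp i :\: <[x i]>).
  apply: limg_dim_eq; apply/eqP; rewrite -subv0; apply/subvP => u.
  rewrite memv_cap memv_ker memv0 => /andP[uC /eqP u0].
  (* A kernel vector [u] is a relation concentrated at index [i]. *)
  pose v : forall j, V j := dfwith (fun j => 0 : V j) u.
  have [|ux _] := @pow_tensor_with_relation x v 0 x0.
    move=> s; rewrite scale0r addr0 big1 ?linear0l// => j _.
    have [<-|ij] := eqVneq i j.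
      by rewrite /v dfwith_in -pow_tensor_mapE.
    by rewrite /v dfwith_out// -pow_tensor_mapE linear0.
  by apply/eqP/(perp_diff_line uC); have := ux i; rewrite /v dfwith_in.
have dsA : \dim (\sum_i A i)%VS = (\sum_i \dim (perp i :\: <[x i]>))%N.
  rewrite -(eq_bigr _ (fun i _ => dA i)); apply/directvP => /=.
  apply/directv_sum_independent => v vA v0 i _.
  have [|//|H _] := rel0 v 0; first by move=> j; apply: vA.
    by rewrite scale0r addr0.
  exact: H.
rewrite singular_conditionsE dimv_disjoint_sum; last first.
  apply/eqP; rewrite -subv0; apply/subvP => s; rewrite memv_cap => /andP[].
  case: ifP => // _ /memv_sumP[v vA ->] /vlineP[c vc].
  (* A common vector of the sum and the line gives a relation with coefficient [- c]. *)
  have [i||_ /eqP] := rel0 v (- c); first exact: vA.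
    by rewrite vc scaleNr subrr.
  by rewrite oppr_eq0 => /eqP c0; rewrite memv0 vc c0 scale0r.
rewrite dsA -(eq_bigr _ (fun i _ => dim_perp_diff i)) big_split /= -sum1_card.
rewrite [in RHS]big_mkcond /= addnAC.
congr (_ + _)%N; last first.
  by case: ifP; rewrite ?dimv0 ?dim_vline ?pow_tensor_neq0.
congr (_ + _)%N; rewrite [LHS]big_mkcond /=.
by apply: eq_bigr => i _; rewrite inE; case: isotropic.
Qed.

(** A vector of [singular_conditions] orthogonal to all of [S] is a relation, hence 0, so
    [dim_orthov] applies. *)
Lemma dim_singular_space :
  (\dim singular_space + \dim singular_conditions =
   \dim (fullv : {vspace S}))%N.
Proof.
apply: dim_orthov => u; rewrite singular_conditionsE.
case/memv_addP=> _ /memv_sumP[v vA ->] [e eE ->] H.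
have [c ec] : exists c, e = c *: pow_tensor mu tau x.
  move: eE; case: ifP => _; first by case/vlineP=> c; exists c.
  by rewrite memv0 => /eqP->; exists 0; rewrite scale0r.
rewrite ec in H *.
have [|v0 ->] := singular_conditions_relation _ H; first by move=> i; apply: vA.
by rewrite big1 ?scale0r ?addr0.
Qed.

(** This puts a point in every fiber: the pairing has the factor [q i y (x i) = 0]. *)
Lemma pow_tensor_singular : singular_tuple q mu tau qF (pow_tensor mu tau x) x.
Proof.
apply/(singular_tupleP _ x0) => i y xy.
by rewrite sym_formC frobenius_pow_tensor_with (sym_formC (q i)) xy mul0r mulr0.
Qed.

End Fiber.

End Spectral.

(** * Representatives of projective points *)

Section ProjClass.
Variables (K : fieldType) (V : vectType K).

Lemma proj_class_neq0 (x : V) p : proj_class x p -> x != 0.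
Proof.
move=> xp; have := valP p; rewrite xp dim_vline.
by case: (x != 0).
Qed.

Lemma proj_class_ex (p : projective V) : exists x, proj_class x p.
Proof.
exists (vpick (val p)); apply/esym/eqP.
have p0 : val p != 0%VS by rewrite -dimv_eq0 (eqP (valP p)).
rewrite eqEdim -memvE memv_pick (eqP (valP p)) dim_vline.
by rewrite vpick0 p0.
Qed.

Lemma proj_class_line (x : V) : x != 0 -> exists p, proj_class x p.
Proof.
move=> x0; have d1 : \dim <[x]> == 1%N by rewrite dim_vline x0.
by exists (exist _ <[x]>%VS d1).
Qed.

End ProjClass.

Lemma proj_class_scale (K : fieldType) (I : Type) (V : I -> vectType K)
    (x y : forall i, V i) (p : forall i, projective (V i)) :
  (forall i, proj_class (x i) (p i)) -> (forall i, proj_class (y i) (p i)) ->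
  exists c, y = fun i => c i *: x i.
Proof.
move=> xp yp.
have /choice[c cP] i : exists c, y i = c *: x i.
  by apply/vlineP; rewrite -(xp i : val _ = _) (yp i : val _ = _) memv_line.
by exists c; apply: functional_extensionality_dep.
Qed.

(** * Surjectivity of the projection and codimension of its fibers *)

Theorem theorem13 (R : realType) (k : nat) (hk : (1 <= k)%N)
    (n : 'I_k -> nat) (hn : forall i, (1 <= n i)%N)
    (w : 'I_k -> nat) (hw : forall i, (1 <= w i)%N)
    (V : 'I_k -> vectType R[i])
    (hV : forall i, \dim (fullv : {vspace V i}) = n i)
    (q : forall i, {symmetric (V i)})
    (hq : forall i, complexified_posdef (q i))
    (Sym : 'I_k -> vectType R[i])
    (mu : forall i, ('I_(w i) -> V i) -> Sym i)
    (hSym : forall i, is_sym_power (mu i))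
    (S : vectType R[i]) (tau : (forall i, Sym i) -> S)
    (hS : is_tensor_product tau)
    (qF : {symmetric S}) (hqF : is_frobenius q mu tau qF) :
  let Sigma := spectral_variety q mu tau qF in
  let alpha := fun t : projective S * (forall i, projective (V i)) => t.1 in
  let beta := fun t : projective S * (forall i, projective (V i)) => t.2 in
  set_surj Sigma [set: forall i, projective (V i)] beta /\
  forall (x : forall i, V i) (p : forall i, projective (V i)) (r : nat),
    (forall i, proj_class (x i) (p i)) ->
    #|[pred i | isotropic q (x i)]| = r ->
    exists F : {vspace S},
      [/\ set_inj (Sigma `&` beta @^-1` [set p]) alpha,
          alpha @` (Sigma `&` beta @^-1` [set p]) = proj_subspace F &
          proj_codim F = \sum_i ((n i)%:Z - 1) - Num.max 0 (r%:Z - 1)].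
Proof.
move=> Sigma alpha beta; split.
  move=> p _.
  have xex i : {x | proj_class x (p i)} by apply: cid; apply: proj_class_ex.
  pose x i := projT1 (xex i).
  have xp i : proj_class (x i) (p i) := projT2 (xex i).
  have x0 i := proj_class_neq0 (xp i).
  have [L LP] := proj_class_line (pow_tensor_neq0 hw hq hSym hS hqF x0).
  exists (L, p) => //; exists (pow_tensor mu tau x), x; split=> //.
  exact: (pow_tensor_singular hw hq hSym hS hqF x0).
move=> x p r xp xr; have x0 i := proj_class_neq0 (xp i).
have memF := mem_singular_space hw hq hSym hS qF x0.
pose F := singular_space hw q hSym hS qF x.
exists F; split.
- by move=> [L p1] [L' p2] /set_mem[_ /= p1p] /set_mem[_ /= p2p] LL';
    rewrite p1p p2p; congr pair.
- apply/seteqP; split=> [_ [[L p'] [[T [x' [/= TL x'p' Tx']]] p'p] <-]|L LF].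
    rewrite /= in p'p; rewrite p'p in x'p'.
    rewrite /proj_subspace /= (TL : val _ = _) -memvE; apply/memF.
    (* The point of [Sigma] may come with other representatives [x'] of the same classes. *)
    have [c cE] := proj_class_scale x'p' xp; rewrite cE.
    by apply: (singular_tuple_scale hw hq hSym hS) => // i; move: (x0 i); rewrite cE.
  have [T TL] := proj_class_ex L.
  exists (L, p) => //; split=> //; exists T, x; split=> //; apply/memF.
  by move: LF; rewrite /proj_subspace /= (TL : val _ = _) -memvE.
have := dim_singular_space hw hq hSym hS hqF x0.
have := dim_singular_conditions hw hq hSym hS hqF x0.
have -> : [exists i, isotropic q (x i)] = (0 < r)%N.
  by rewrite -xr; apply/existsP/card_gt0P.
rewrite xr -/F /proj_codim /proj_dim => dU <-.
have -> : \sum_i ((n i)%:Z - 1) = (\sum_i (\dim (fullv : {vspace V i})).-1)%N%:Z.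
  rewrite (big_morph Posz PoszD (erefl 0%:Z)); apply: eq_bigr => i _.
  by rewrite hV predn_int.
(* The codimension equals the dimension of [singular_conditions], and the correction [r - (0 < r)]
   is [max 0 (r - 1)] in both cases. *)
rewrite PoszD; case: r dU xr => [|r] dU xr; lia.
Qed.
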